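(* Let $n,k,\ell$ be positive integers, and let $\Gamma=\mathrm{Cay}(\mathbb{Z}_n,\{x^k,x^{-k},x^\ell,x^{-\ell}\})$ be a connected circulant quartic graph. Then: (i) If $k\equiv1\pmod 3$ and $\ell\equiv0\pmod 3$, or $\ell\equiv1\pmod 3$ and $k\equiv0\pmod 3$, then $\Gamma$ contains a $(2,1)$-regular set if and only if $n$ is a multiple of $3$. (ii) If $k\equiv1\pmod 3$ and $\ell\equiv1\pmod 3$, then $\Gamma$ contains no $(2,1)$-regular set.
   Context: $\mathbb{Z}_n=\langle x\rangle$ denotes the cyclic group of order $n$, written multiplicatively. For a finite group $G$ with identity $e$ and an inverse-closed subset $S\subseteq G\setminus\{e\}$, the Cayley graph $\mathrm{Cay}(G,S)$ is the simple graph with vertex set $G$ in which $y$ and $z$ are adjacent if and only if $y^{-1}z\in S$. A circulant quartic graph is a graph $\mathrm{Cay}(\mathbb{Z}_n,\{x^k,x^{-k},x^\ell,x^{-\ell}\})$ where $x^k,x^{-k},x^\ell,x^{-\ell}$ are four distinct non-identity elements. For a graph $\Gamma$ and nonnegative integers $a,b$, a nonempty proper subset $C$ of $V(\Gamma)$ is an $(a,b)$-regular set of $\Gamma$ if every vertex in $C$ has exactly $a$ neighbours in $C$ and every vertex in $V(\Gamma)\setminus C$ has exactly $b$ neighbours in $C$. *)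

(* Defs.v *)
From mathcomp Require Import all_boot all_fingroup.
Set Implicit Arguments.
Unset Strict Implicit.
Unset Printing Implicit Defensive.

Import GroupScope.

(* Graphs are adjacency relations; simplicity is symmetry plus irreflexivity. *)
Section Graphs.
Variables (T : finType) (e : rel T).

Definition simple_graph : Prop := symmetric e /\ irreflexive e.

Definition connected_graph : Prop := forall y z : T, connect e y z.

Definition regular_set (a b : nat) (C : {set T}) : Prop :=
  [/\ C != set0,
      C \proper [set: T],
      forall v, v \in C -> #|[set w in C | e v w]| = a
    & forall v, v \notin C -> #|[set w in C | e v w]| = b].

End Graphs.

Section Cayley.
Variable gT : finGroupType.
Implicit Types (S : {set gT}) (x : gT).

Definition Cay S : rel gT := fun y z => y^-1 * z \in S.

Lemma Cay_simple S :
  (forall s, s \in S -> s^-1 \in S) -> 1 \notin S -> simple_graph (Cay S).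
Proof.
move=> SV S1; split=> [y z | y]; last by rewrite /Cay mulVg (negPf S1).
have h u v : Cay S u v -> Cay S v u.
  by rewrite /Cay => /SV; rewrite invMg invgK.
by apply/idP/idP; apply: h.
Qed.

Definition circulant_set x (k l : nat) : {set gT} :=
  [set x ^+ k; x ^- k; x ^+ l; x ^- l].

Definition quartic_parameters x (k l : nat) : bool :=
  uniq [:: 1; x ^+ k; x ^- k; x ^+ l; x ^- l].

Lemma circulant_simple x k l :
  quartic_parameters x k l -> simple_graph (Cay (circulant_set x k l)).
Proof.
case/andP=> S1 _; apply: Cay_simple => [s|].
  rewrite !inE -!orbA => /or4P[] /eqP->;
  by rewrite ?invgK eqxx ?orbT.
by move: S1; rewrite !inE -!orbA.
Qed.

End Cayley.

(* Main.v *)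
Require Import Defs.
From mathcomp Require Import all_boot all_fingroup.
From mathcomp Require Import all_algebra cyclic all_field.
From mathcomp Require Import ring zify.
Set Implicit Arguments.
Unset Strict Implicit.
Unset Printing Implicit Defensive.

Import GRing.Theory Num.Theory.
Import GroupScope.

(** Summing the defining condition of a (2,1)-regular set [C] against a
    character [phi] of the cyclic group counts the same edges from their two
    ends, and gives
      [phi(C) * lambda = 2 * phi(C) + phi(~: C)],
    where [phi(C)] is the sum of [phi] over [C] and [lambda] is the eigenvalue
    [y^k + y^-k + y^l + y^-l] with [y = phi x] (lemma [regular_set_char]).
    The trivial character has [lambda = 4] and yields [3 * #|C| = n], which is
    the necessity of [3 %| n].  When [n] is a multiple of 3 and exactly one of
    [k], [l] is, the other being 1 mod 3, the powers of [x ^+ 3] form a regular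
    set (lemma [cycle3_regular_set]).

    Suppose now that 3 divides neither [k] nor [l].  For a nontrivial [phi] the
    values of [phi] sum to 0 over the group, so the relation reads
    [phi(C) * (lambda - 1) = 0].  The eigenvalue 1 does occur in some such
    graphs, but never for a character whose order is a power [3 ^ j], [j > 0]
    (lemma [pow3_root_eigenvalue]):
    - if [j = 1], then [y^k + y^-k = y^l + y^-l = -1], and [lambda = -2];
    - if [j > 1], the trace from the field of [y] down to that of [y ^+ 3] maps
      [y^i] to 0 whenever 3 does not divide [i], hence maps [lambda] to 0,
      whereas it maps 1 to 3.
    So [phi(C) = 0] for all nontrivial characters whose order divides the 3-part
    [N] of [n].  By Fourier inversion [C] is equidistributed among the [N]
    cosets of the subgroup of index [N], whence [N %| #|C|].  Together with
    [3 * #|C| = n] this makes [3 * N] a divisor of [n], contradicting the choice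
    of [N]. *)

(** * Counting neighbours in Cayley graphs *)

Section CirculantSet.
Variables (gT : finGroupType) (x : gT) (k l : nat).

Lemma circulant_setC : circulant_set x l k = circulant_set x k l.
Proof.
by apply/setP=> s; rewrite !inE; do 4![case: (s == _)].
Qed.

Lemma quartic_parametersC : quartic_parameters x k l -> quartic_parameters x l k.
Proof.
rewrite /quartic_parameters /= !inE !negb_or !(eq_sym (x ^+ l)) !(eq_sym (x ^- l)).
by do ![case: (_ == _)].
Qed.

Lemma sum_circulant (V : nmodType) (g : gT -> V) : quartic_parameters x k l ->
  (\sum_(s in circulant_set x k l) g s
     = g (x ^+ k)%g + g (x ^- k)%g + (g (x ^+ l)%g + g (x ^- l)%g))%R.
Proof.
case/andP=> _ S_uniq.
rewrite (eq_bigl (mem [:: x ^+ k; x ^- k; x ^+ l; x ^- l])); last first.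
  by move=> s; rewrite !inE -!orbA.
by rewrite -big_uniq //= !big_cons big_nil addr0 !addrA.
Qed.

End CirculantSet.

Section RegularSets.
Variables (gT : finGroupType) (S C : {set gT}).

Lemma card_neighbours v :
  #|[set w in C | Cay S v w]| = (\sum_(s in S) ((v * s)%g \in C))%N.
Proof.
rewrite -sum1_card (reindex (mulg v)) /=; last first.
  by exists (mulg v^-1) => w _; rewrite ?mulKg ?mulKVg.
rewrite big_mkcond [RHS]big_mkcond; apply: eq_bigr => s _.
by rewrite !inE /Cay mulKg; do 2!case: (_ \in _).
Qed.

(** Double counting: the left-hand side is the sum of [phi] over the pairs of a
    vertex [c * s^-1] and its neighbour [c] in [C], grouped by [c]; the
    right-hand side groups the same pairs by the vertex. *)
Lemma regular_set_char (F : fieldType) (phi : gT -> F) a b :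
    {morph phi : u v / u * v >-> (u * v)%R} ->
    regular_set (Cay S) a b C ->
  ((\sum_(c in C) phi c) * (\sum_(s in S) phi s^-1%g)
     = (\sum_(c in C) phi c) *+ a + (\sum_(c in ~: C) phi c) *+ b)%R.
Proof.
move=> phiM [_ _ inC outC].
transitivity (\sum_v phi v *+ #|[set w in C | Cay S v w]|)%R; last first.
  rewrite (bigID (mem C)) /= -!sumrMnl; congr (_ + _)%R.
    by apply: eq_bigr => v /inC->.
  by apply: eq_big => [v|v /outC->//]; rewrite inE.
rewrite mulr_sumr.
under [RHS]eq_bigr do rewrite card_neighbours -sumrMnr.
rewrite exchange_big; apply: eq_bigr => s _.
rewrite mulr_suml big_mkcond (reindex (mulg^~ s)) /=; last first.
  by exists (mulg^~ s^-1) => w _; rewrite ?mulgK ?mulgKV.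
by apply: eq_bigr => v _; case: ifP; rewrite ?mulr0n // -phiM mulgK.
Qed.

End RegularSets.

(** * Characters of a cyclic group *)

Section CyclicCharacters.
Variables (gT : finGroupType) (x : gT).
Hypothesis x_gen : [set: gT] = <[x]>.

Lemma expg_of v : exists i, v = x ^+ i.
Proof. by apply/cycleP; rewrite -x_gen inE. Qed.

Lemma exists_char (F : fieldType) (z : F) : (z ^+ #[x] = 1)%R ->
  exists2 phi : gT -> F, {morph phi : u v / u * v >-> (u * v)%R}
                       & forall i, phi (x ^+ i)%g = (z ^+ i)%R.
Proof.
have expg_of_eq v : exists i, v == x ^+ i by have [i ->] := expg_of v; exists i.
move=> zx; pose log v := xchoose (expg_of_eq v).
have phiX i : (z ^+ log (x ^+ i)%g = z ^+ i)%R.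
  rewrite -(expr_mod _ zx) -[RHS](expr_mod _ zx); congr (_ ^+ _)%R.
  by apply/eqP; rewrite -eq_expg_mod_order eq_sym (xchooseP (expg_of_eq _)).
exists (fun v => z ^+ log v)%R => // u v.
have [[i ->] [j ->]] := (expg_of u, expg_of v).
by rewrite -expgD !phiX exprD.
Qed.

Lemma sum_char0 (F : fieldType) (phi : gT -> F) :
  {morph phi : u v / u * v >-> (u * v)%R} -> (phi x != 1 ->
  \sum_v phi v = 0)%R.
Proof.
move=> phiM phix; apply/eqP.
have: (\sum_v phi v == phi x * \sum_v phi v)%R.
  rewrite mulr_sumr (reindex (mulg x)) /=; last first.
    by exists (mulg x^-1) => w _; rewrite ?mulKg ?mulKVg.
  by apply/eqP/eq_bigr => v _; rewrite phiM.
rewrite -subr_eq0 -{1}[(\sum_v _)%R]mul1r -mulrBl mulf_eq0 subr_eq0 eq_sym.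
by rewrite (negPf phix).
Qed.

End CyclicCharacters.

(** A set whose moments against an [N]-th root of unity valued [phi] vanish is
    equidistributed along [phi]: orthogonality of the powers of [phi] singles
    out the [c] with [phi c = 1], and they make up [1/N] of [C]. *)
Lemma dvdn_card_moments0 (T : finType) (F : numFieldType) (C : {set T})
    (phi : T -> F) N :
    0 < N -> (forall c, phi c ^+ N = 1)%R ->
    (forall i, (0 < i < N)%N -> \sum_(c in C) phi c ^+ i = 0)%R ->
  N %| #|C|.
Proof.
move=> N_gt0 phiN sum0.
have : (\sum_(i < N) \sum_(c in C) phi c ^+ i = #|C|%:R)%R.
  rewrite (bigD1 (Ordinal N_gt0)) //= [X in (_ + X)%R]big1 => [|i i_neq0].
    rewrite addr0 -sumr_const; apply: eq_bigr => c _; exact: expr0.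
  by rewrite sum0 // ltn_ord lt0n andbT.
rewrite exchange_big /= (bigID (fun c => phi c == 1%R)) /=.
rewrite [X in (_ + X)%R]big1 => [|c /andP[_ phic]]; last first.
  apply/eqP; have : ((phi c - 1) * \sum_(i < N) phi c ^+ i == 0)%R.
    by rewrite -subrX1 phiN subrr.
  by rewrite mulf_eq0 subr_eq0 (negPf phic).
rewrite addr0 (eq_bigr (fun=> N%:R%R)) => [|c /andP[_ /eqP->]]; last first.
  by under eq_bigr do rewrite expr1n; rewrite sumr_const card_ord.
rewrite sumr_const -mulrnA => /eqP; rewrite eqr_nat => /eqP<-.
exact: dvdn_mulr.
Qed.

(** * The eigenvalue 1 and roots of unity of 3-power order *)

Section Eigenvalue.
Local Open Scope ring_scope.

Lemma geometric3_eq0 (F : fieldType) (w : F) :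
  w ^+ 3 = 1 -> w != 1 -> 1 + w + w ^+ 2 = 0.
Proof.
move=> w3 w_n1; apply/eqP.
have: (w - 1) * (1 + w + w ^+ 2) == 0.
  have -> : (w - 1) * (1 + w + w ^+ 2) = w ^+ 3 - 1 by ring.
  by rewrite w3 subrr.
by rewrite mulf_eq0 subr_eq0 (negPf w_n1).
Qed.

Lemma cube_root_eigenvalue (F : numFieldType) (y z : F) :
    y ^+ 3 = 1 -> y != 1 -> z ^+ 3 = 1 -> z != 1 ->
  y + y^-1 + (z + z^-1) != 1.
Proof.
have sumN1 (w : F) : w ^+ 3 = 1 -> w != 1 -> w + w^-1 = -1.
  move=> w3 w1; have -> : w^-1 = w ^+ 2 by apply: mulr1_eq; rewrite -exprS.
  by apply/eqP; rewrite -subr_eq0 opprK addrC addrA geometric3_eq0.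
move=> y3 y1 z3 z1; rewrite !sumN1 // -opprD -subr_eq0 -opprD oppr_eq0.
by rewrite -addrA (pnatr_eq0 F 3).
Qed.

(** The automorphism [u] multiplies [y] by the nontrivial cube root of unity
    [y ^+ M], which it fixes because 3 divides [M]; so [y], [u y], [u (u y)]
    are the three cube roots of [y ^+ 3]. *)
Lemma twisted_trace_eq0 (M : nat) (u : {rmorphism algC -> algC}) (y : algC) :
    (3 %| M)%N -> (forall t, t ^+ (3 * M) = 1 -> u t = t ^+ M.+1) ->
    y ^+ (3 * M) = 1 -> y ^+ M != 1 ->
  y + u y + u (u y) = 0.
Proof.
move=> M3 uE yN yM; pose w := y ^+ M.
have w3 : w ^+ 3 = 1 by rewrite -exprM mulnC.
have wM : w ^+ M = 1 by rewrite -(divnK M3) mulnC exprM w3 expr1n.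
have uy : u y = y * w by rewrite uE // exprS.
have uw : u w = w by rewrite uE ?exprS ?wM ?mulr1 // exprM w3 expr1n.
rewrite uy rmorphM uy uw.
have -> : y + y * w + y * w * w = y * (1 + w + w ^+ 2) by ring.
by rewrite geometric3_eq0 ?mulr0.
Qed.

(** For [y] of order at least 9, an automorphism of order 3 over the field of
    [y ^+ 3] has trace 0 on each of the four summands but trace 3 on 1. *)
Lemma pow3_root_eigenvalue a k l (y : algC) :
    y ^+ (3 ^ a) = 1 -> y != 1 -> ~~ (3 %| k)%N -> ~~ (3 %| l)%N ->
  y ^+ k + y ^- k + (y ^+ l + y ^- l) != 1.
Proof.
move=> ya y1 k3 l3.
have [|d y_prim d_dvd] := prim_order_exists _ ya; first by rewrite expn_gt0.
have [j _ dE] : exists2 j, (j <= a)%N & d = (3 ^ j)%N by apply/dvdn_pfactor.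
case: j dE => [|j] dE.
  by move: y1; rewrite -[y]expr1 -(prim_order_dvd y_prim) dE.
have rootX i : (y ^+ i) ^+ (3 ^ j.+1) = 1.
  by rewrite exprAC -dE (prim_expr_order y_prim) expr1n.
have rootXneq i : ~~ (3 %| i)%N -> (y ^+ i) ^+ (3 ^ j) != 1.
  move=> i3; rewrite -exprM -(prim_order_dvd y_prim) dE expnS.
  by rewrite dvdn_pmul2r ?expn_gt0.
case: j => [|j] in dE rootX rootXneq *.
  by apply: cube_root_eigenvalue; rewrite ?rootX // -[y ^+ _]expr1 rootXneq.
(* Raising to the power [1 + M] multiplies a primitive root of order [3 * M]
   by a cube root of unity; [3 %| M] makes [1 + M] a unit mod [3 * M]. *)
pose M := (3 ^ j.+1)%N.
have M3 : (3 %| M)%N by rewrite dvdn_exp.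
have [|u uE] := @Qn_aut_exists M.+1 (3 * M).
  rewrite coprimeMr coprimeSn andbT coprime_sym prime_coprime //.
  by rewrite -(addn1 M) dvdn_addr.
rewrite -expnS in uE.
have tr0 := twisted_trace_eq0 M3 uE.
have trX i : ~~ (3 %| i)%N -> y ^+ i + u (y ^+ i) + u (u (y ^+ i)) = 0.
  by move=> i3; rewrite tr0 ?rootXneq.
have trV i : ~~ (3 %| i)%N -> y ^- i + u (y ^- i) + u (u (y ^- i)) = 0.
  move=> i3; rewrite tr0 // exprVn ?rootX ?invr1 //.
  by rewrite invr_eq1 rootXneq.
apply/eqP=> eig1.
have : 1 + u 1 + u (u 1) == 0.
  rewrite -eig1 !rmorphD /=; apply/eqP.
  transitivity ((y ^+ k + u (y ^+ k) + u (u (y ^+ k)))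
    + (y ^- k + u (y ^- k) + u (u (y ^- k)))
    + ((y ^+ l + u (y ^+ l) + u (u (y ^+ l)))
    + (y ^- l + u (y ^- l) + u (u (y ^- l))))); first by ring.
  by rewrite !trX // !trV // !addr0.
by rewrite !rmorph1 -addrA (pnatr_eq0 algC 3).
Qed.

End Eigenvalue.

(** * Regular sets of circulant quartic graphs *)

Section Circulant.
Variables (gT : finGroupType) (x : gT) (k l : nat).
Hypothesis x_gen : [set: gT] = <[x]>.
Hypothesis quartic : quartic_parameters x k l.
Notation Gamma := (Cay (circulant_set x k l)).

(** The edge count against the trivial character. *)
Lemma card_regular_set C : regular_set Gamma 2 1 C -> (3 * #|C| = #|gT|)%N.
Proof.
move/(regular_set_char (phi := fun=> 1%R : rat)) => /(_ (fun _ _ => esym (mulr1 _))).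
rewrite sum_circulant // !sumr_const (_ : _ + _ + _ = 4%:R)%R //.
rewrite -natrM -!mulrnA -natrD.
by move/eqP; rewrite eqr_nat -(cardsC C) => /eqP; lia.
Qed.

(** The edge count gives [psi(C) * (lambda - 1) = 0], where [psi(C)] is the sum
    below, and [lambda != 1] because [y] has 3-power order. *)
Lemma regular_set_char_sum0 C a (psi : gT -> algC) (y : algC) :
    ~~ (3 %| k) -> ~~ (3 %| l) -> regular_set Gamma 2 1 C ->
    {morph psi : u v / u * v >-> (u * v)%R} ->
    (forall i, psi (x ^+ i)%g = y ^+ i)%R -> (y ^+ (3 ^ a) = 1)%R -> y != 1%R ->
  (\sum_(c in C) psi c = 0)%R.
Proof.
move=> k3 l3 regC psiM psiX ya y1.
have psiV v : psi v^-1 = (psi v)^-1%R.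
  by apply/esym/mulr1_eq; rewrite -psiM mulgV -(expg0 x) psiX.
have := @sum_char0 _ x _ _ psiM.
rewrite -{1}[x]expg1 psiX expr1 => /(_ y1).
rewrite (bigID (mem C)) /= => /eqP; rewrite addr_eq0 => /eqP sumC.
have sumC' : (\sum_(c in ~: C) psi c = - \sum_(c in C) psi c)%R.
  by rewrite sumC opprK; apply: eq_bigl => v; rewrite inE.
have := regular_set_char psiM regC.
rewrite sumC' sum_circulant // !invgK !psiV !psiX mulr1n mulr2n addrK.
rewrite -[RHS]mulr1 => /eqP; rewrite -subr_eq0 -mulrBr mulf_eq0 subr_eq0.
rewrite ![(_ ^- _ + _)%R]addrC (negPf (pow3_root_eigenvalue ya y1 k3 l3)) orbF.
by move/eqP.
Qed.

(** Every nontrivial power of a character of order [3 ^ logn 3 #|gT|] has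
    3-power order, hence sums to 0 over [C]. *)
Lemma pow3_dvd_card_regular_set C : ~~ (3 %| k) -> ~~ (3 %| l) ->
  regular_set Gamma 2 1 C -> 3 ^ logn 3 #|gT| %| #|C|.
Proof.
move=> k3 l3 regC; set N := (3 ^ _)%N.
have N_gt0 : (0 < N)%N by rewrite expn_gt0.
have [z z_prim] := C_prim_root_exists N_gt0.
have zx : (z ^+ #[x] = 1)%R.
  apply/eqP; rewrite -(prim_order_dvd z_prim) orderE -x_gen cardsT.
  exact: pfactor_dvdnn.
have [phi phiM phiX] := exists_char x_gen zx.
have zN i : ((z ^+ i) ^+ N = 1)%R.
  by rewrite exprAC (prim_expr_order z_prim) expr1n.
apply: (dvdn_card_moments0 (phi := phi)) => // [v | i /andP[i_gt0 i_lt]].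
  by have [i ->] := expg_of x_gen v; rewrite phiX.
apply: (regular_set_char_sum0 k3 l3 regC _ _ (zN i)) => [u v|j|].
- by rewrite phiM exprMn.
- by rewrite phiX exprAC.
- by rewrite -(prim_order_dvd z_prim) gtnNdvd.
Qed.

Lemma no_regular_set C : ~~ (3 %| k) -> ~~ (3 %| l) -> ~ regular_set Gamma 2 1 C.
Proof.
move=> k3 l3 regC.
have := pow3_dvd_card_regular_set k3 l3 regC.
rewrite -(dvdn_pmul2l (isT : 0 < 3)%N) -expnS (card_regular_set regC).
by rewrite pfactor_dvdn ?ltnn // -cardsT cardG_gt0.
Qed.

(** In the cycle of cosets [H], [H * x], [H * x^2] the elements [x ^+ l] and
    [x ^- l] keep a vertex in its coset, while [x ^+ k] and [x ^- k] move it one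
    step forward and one step back; so a vertex of [H] has two neighbours in [H]
    and a vertex outside [H] has one. *)
Lemma cycle3_regular_set : 3 %| #|gT| -> k = 1 %[mod 3] -> l = 0 %[mod 3] ->
  regular_set Gamma 2 1 <[x ^+ 3]>.
Proof.
move=> n3 k1 l0; set H := <[x ^+ 3]>%G.
have ox : #[x] = #|gT| by rewrite -cardsT x_gen.
have H3 i : (x ^+ i \in H) = (3 %| i)%N.
  apply/cycleP/idP=> [[j /eqP]|/dvdnP[q ->]]; last first.
    by exists q; rewrite -expgM mulnC.
  rewrite -expgM eq_expg_mod_order ox => /eqP.
  move/(congr1 (modn^~ 3)); rewrite !modn_dvdm // => e.
  by rewrite /dvdn e modnMr.
have xk v : (v * x ^+ k \in H) = (v * x \in H).
  rewrite (divn_eq k 3) k1 addnC expgD expg1 mulgA groupMr //.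
  by rewrite H3 dvdn_mull.
have xkV v : (v * x ^- k \in H) = (v * x^-1 \in H).
  rewrite (divn_eq k 3) k1 expgD expg1 invMg mulgA groupMr //.
  by rewrite groupV H3 dvdn_mull.
have xl : x ^+ l \in H by rewrite H3 /dvdn l0.
have xlV : x ^- l \in H by rewrite groupV.
have nbE v : #|[set w in H | Gamma v w]| =
    ((v * x \in H)%g + (v * x^-1 \in H)%g + (v \in H).*2)%N.
  rewrite -addnn card_neighbours sum_circulant // xk xkV.
  by rewrite (groupMr v xl) (groupMr v xlV).
have x1 : x \notin H by rewrite -[x]expg1 H3.
split.
- by apply/set0Pn; exists 1; apply: group1.
- by rewrite properE subsetT; apply/subsetPn; exists x.
- by move=> v vH; rewrite nbE vH !groupMl // groupV (negPf x1).
- move=> v; rewrite nbE; have [i ->] := expg_of x_gen v; case: i => [|i].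
    by rewrite group1.
  have -> : x ^+ i.+1 * x^-1 = x ^+ i by rewrite expgSr mulgK.
  by rewrite -expgSr !H3; lia.
Qed.

End Circulant.

Theorem theorem6p2p4 (n k l : nat) (n_gt0 : 0 < n) (k_gt0 : 0 < k)
    (l_gt0 : 0 < l) (gT : finGroupType) (x : gT)
    (Zn_gen : [set: gT] = <[x]>) (Zn_order : #|[set: gT]| = n)
    (quartic : quartic_parameters x k l)
    (conn : connected_graph (Cay (circulant_set x k l))) :
  ((k = 1 %[mod 3] /\ l = 0 %[mod 3]) \/ (l = 1 %[mod 3] /\ k = 0 %[mod 3]) ->
    ((exists C : {set gT}, regular_set (Cay (circulant_set x k l)) 2 1 C)
      <-> 3 %| n)) /\
  (k = 1 %[mod 3] /\ l = 1 %[mod 3] ->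
    ~ exists C : {set gT}, regular_set (Cay (circulant_set x k l)) 2 1 C).
Proof.
rewrite cardsT in Zn_order; split=> [kl | [k1 l1] [C]]; last first.
  by apply: no_regular_set; rewrite // /dvdn ?k1 ?l1.
split=> [[C /card_regular_set-/(_ quartic) cardC] | n3].
  by rewrite -Zn_order -cardC dvdn_mulr.
rewrite -Zn_order in n3.
exists <[x ^+ 3]>; case: kl => [[k1 l0] | [l1 k0]].
  exact: cycle3_regular_set.
rewrite -circulant_setC; apply: cycle3_regular_set => //.
exact: quartic_parametersC.
Qed.
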